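(* For any natural number $m\geqslant 1$ and any $n\geqslant 0$, there is a bijection between the set of maximal chains in the poset $\Sigma_n C_{m-1}^n$ obtained by stacking $C_{m-1}^0\to C_{m-1}^1\to\dots\to C_{m-1}^n$ and the set of $m$-partitions of a set with $mn$ elements. Consequently, the number of maximal chains in $\Sigma_n C_{m-1}^n$ is $\frac{(mn)!}{(m!)^n\, n!}$.
   Context: For $r\geqslant 0$, $C_r$ denotes the chain $\{0<1<\dots<r\}$, and $C_r^n$ its $n$-th cartesian power with the componentwise order. The maps $C_r^i\to C_r^{i+1}$ used for stacking are $(x_1,\dots,x_i)\mapsto(0,x_1,\dots,x_i)$. Stacking (lax sum): given posets $M_0,\dots,M_n$ and monotone maps $f_j\colon M_j\to M_{j+1}$, the poset $\Sigma_nM_n$ has elements the pairs $(x,j)$ with $0\leqslant j\leqslant n$, $x\in M_j$, ordered by $(x,j)\leqslant(y,k)$ iff $j\leqslant k$ and $(f_{k-1}\circ\dots\circ f_j)(x)\leqslant y$ in $M_k$ (identity composite when $j=k$). An $m$-partition of a set is a partition of it into blocks each of size exactly $m$. *)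

(* Defs.v *)
From HB Require Import structures.
From mathcomp Require Import all_boot all_order all_algebra.

Set Implicit Arguments.
Unset Strict Implicit.
Unset Printing Implicit Defensive.

Import Order.TTheory.
Local Open Scope order_scope.

Fact laxsum_display : Order.disp_t. Proof. exact: Order.Disp tt tt. Qed.

(* The carrier does not depend on the maps; they are a parameter so that the  *)
(* order below can be attached to it canonically.                             *)
Definition laxsum d (M : nat -> finPOrderType d)
    (f : forall j, {omorphism M j -> M j.+1}) (n : nat) : Type :=
  {j : 'I_n.+1 & M j}.

Section LaxSum.
Context {d : Order.disp_t} (M : nat -> finPOrderType d).
Variable f : forall j, {omorphism M j -> M j.+1}.

(* f_{e+j-1} \o ... \o f_j; the codomains agree because 0 + j and e.+1 + j     *)
(* reduce to j and (e + j).+1.                                                *)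
Fixpoint stack_comp j e : M j -> M (e + j)%N :=
  match e with
  | 0 => fun x => x
  | e'.+1 => fun x => f _ (stack_comp e' x)
  end.

(* The composite for j <= k lands in M (k - j + j), and is cast to M k along  *)
(* subnK : j <= k -> k - j + j = k.                                           *)
Definition lax_le_at j k (x : M j) (y : M k) : bool :=
  if @idP (j <= k)%N is ReflectT le_jk
  then ecast i (M i) (subnK le_jk) (stack_comp (k - j) x) <= y
  else false.

Lemma lax_le_atE j e (x : M j) (y : M (e + j)%N) :
  lax_le_at x y = (stack_comp e x <= y).
Proof.
rewrite /lax_le_at; case: {-}_ / idP => [h|]; last by rewrite leq_addl.
move: (subnK h).
move: (e + j - j)%N => e' E; have Ee : e' = e by apply: (addIn E).
by subst e'; rewrite (eq_irrelevance E erefl).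
Qed.

Lemma lax_le_at_leq j k (x : M j) (y : M k) : lax_le_at x y -> (j <= k)%N.
Proof. by rewrite /lax_le_at; case: {-}_ / idP. Qed.

Lemma lax_le_at_refl j (x : M j) : lax_le_at x x.
Proof. by rewrite (@lax_le_atE j 0). Qed.

Lemma lax_le_at_ler j k (x : M j) (y z : M k) :
  lax_le_at x y -> y <= z -> lax_le_at x z.
Proof.
move=> xy; have := lax_le_at_leq xy => /subnK E; move: (k - j)%N E => e E.
by subst k; move: xy; rewrite !lax_le_atE; apply: le_trans.
Qed.

Lemma lax_le_at_map j k (x : M j) (y : M k) :
  lax_le_at x y -> lax_le_at x (f k y).
Proof.
move=> xy; have := lax_le_at_leq xy => /subnK E; move: (k - j)%N E => e E.
subst k; move: xy; rewrite lax_le_atE (@lax_le_atE _ e.+1) /=.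
exact: omorph_le.
Qed.

Lemma lax_le_at_trans j k l (x : M j) (y : M k) (z : M l) :
  lax_le_at x y -> lax_le_at y z -> lax_le_at x z.
Proof.
move=> xy yz; have := lax_le_at_leq yz => /subnK E.
move: (l - k)%N E => e E; subst l; move: yz; rewrite lax_le_atE.
apply: lax_le_at_ler; elim: e {z} => //= e; exact: lax_le_at_map.
Qed.

Local Notation laxsum n := (laxsum f n).

HB.instance Definition _ n := Finite.copy (laxsum n) {j : 'I_n.+1 & M j}.

Definition lax_le n (u v : laxsum n) := lax_le_at (tagged u) (tagged v).

Lemma lax_le_refl n : reflexive (@lax_le n).
Proof. by move=> u; apply: lax_le_at_refl. Qed.

Lemma lax_le_anti n : antisymmetric (@lax_le n).
Proof.
move=> [j x] [k y] /andP[]; rewrite /lax_le /= => xy yx.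
have jk : j = k.
  by apply/val_inj/eqP; rewrite eqn_leq (lax_le_at_leq xy) (lax_le_at_leq yx).
subst k; move: xy yx; rewrite !(@lax_le_atE j 0) /= => xy yx.
by rewrite (@le_anti _ _ x y) ?xy.
Qed.

Lemma lax_le_trans n : transitive (@lax_le n).
Proof. by move=> v u w; apply: lax_le_at_trans. Qed.

HB.instance Definition _ n :=
  Order.Le_isPOrder.Build laxsum_display (laxsum n)
    (@lax_le_refl n) (@lax_le_anti n) (@lax_le_trans n).

End LaxSum.

Section Cubes.
Variable r : nat.

Definition cube (n : nat) : finPOrderType _ := n.-tupleprod 'I_r.+1.

Definition cube_cons0 n (x : cube n) : cube n.+1 := cons_tuple ord0 x.

Lemma cube_cons0_homo n : {homo @cube_cons0 n : x y / x <= y}.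
Proof.
move=> x y; rewrite !leEtprod => /forallP xy; apply/forallP => i.
by case: (unliftP ord0 i) => [j|] ->; rewrite ?tnthS ?tnth0.
Qed.

HB.instance Definition _ n :=
  Order.isOrderMorphism.Build _ (cube n) _ (cube n.+1) (@cube_cons0 n)
    (@cube_cons0_homo n).

Definition stacked_cubes (n : nat) : finPOrderType laxsum_display :=
  laxsum (fun j => @cube_cons0 j : {omorphism cube j -> cube j.+1}) n.

End Cubes.

Definition chain d (T : finPOrderType d) (A : {set T}) : bool :=
  [forall x in A, forall y in A, x >=< y].

Definition maximal_chain d (T : finPOrderType d) (A : {set T}) : bool :=
  maxset (@chain d T) A.

Definition m_partition (m : nat) (T : finType) (P : {set {set T}}) : bool :=
  partition P [set: T] && [forall B in P, #|B| == m].

(* Main.v *)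
Require Import Defs.
From HB Require Import structures.
From mathcomp Require Import all_boot all_order all_algebra.
From mathcomp Require Import zify ring.

(******************************************************************************)
(* An element of level j of the stacked cubes records the sizes (coordinate   *)
(* plus one) of j blocks; listing them from the oldest block to the newest    *)
(* and padding with zeros embeds the stacked poset into nat^n with the        *)
(* componentwise order, with image the sequences bounded by m whose zeros all *)
(* come last. Lower covers are then the decrements of one entry, and the      *)
(* number of maximal chains below an element is the sum of these numbers over *)
(* its lower covers. By Pascal's rule the solution of this recurrence is      *)
(* \prod_i 'C(s_i + s_(i+1) + ... + s_n - 1, s_i - 1), the number of set      *)
(* partitions whose blocks, ordered by their least elements, have sizes s_i.  *)
(* At the top, where all s_i = m, it equals the number of m-partitions, which *)
(* is computed by removing the block of a given element. The bijection comes  *)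
(* from the equality of the two cardinals.                                    *)
(******************************************************************************)

Set Implicit Arguments.
Unset Strict Implicit.
Unset Printing Implicit Defensive.

Import Order.TTheory.

(** * Chains below an element *)

(** Read upwards, step k of a maximal chain puts the k-th element into the block whose size grows;
    blocks open in the order of their least elements, so a chain ending at sizes [s] encodes a set
    partition with these block sizes. The proof only compares the counts.
    [card_max_chain_below_cover] gives the recurrence over lower covers, [covered_by_block_sizes]
    turns these covers into decrements, and [path_count_decrements] shows that the product of
    binomials solves the recurrence. [card_m_partition_of] finds the same product at the top sizes,
    and [prod_bin_fact] telescopes it into factorials. A size is a coordinate plus one, so that a
    block with coordinate 0 differs from an absent one. *)

Section ChainsBelow.
Local Open Scope order_scope.
Context {d : Order.disp_t} {T : finPOrderType d}.
Implicit Types (x y z : T) (A B : {set T}).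

Lemma chainP A : reflect {in A &, forall x y, x >=< y} (chain A).
Proof.
apply: (iffP forall_inP) => [cA x y Ax Ay | cA x Ax].
  exact: (forall_inP (cA x Ax)).
by apply/forall_inP => y Ay; apply: cA.
Qed.

Definition max_chain_below x A : bool :=
  [&& chain A, A \subset [set y | y <= x] &
      [forall z, (z <= x) && [forall a in A, z >=< a] ==> (z \in A)]].

Definition covered_by x y : bool :=
  (y < x) && [forall z, ~~ ((y < z) && (z < x))].

Lemma max_chain_belowP x A :
  reflect [/\ chain A, forall a, a \in A -> a <= x &
      forall z, z <= x -> (forall a, a \in A -> z >=< a) -> z \in A]
    (max_chain_below x A).
Proof.
apply: (iffP and3P) => [[cA /subsetP Ax mA] | [cA Ax mA]]; split=> //.
- by move=> a /Ax; rewrite inE.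
- move=> z zx zA; apply: (implyP (forallP mA z)); rewrite zx.
  by apply/forall_inP.
- by apply/subsetP => a /Ax; rewrite inE.
- by apply/forallP => z; apply/implyP => /andP[zx /forall_inP]; apply: mA.
Qed.

Lemma max_chain_below_top x A : max_chain_below x A -> x \in A.
Proof.
by case/max_chain_belowP=> _ Ax mA; apply: mA => // a /Ax; apply: ge_comparable.
Qed.

Lemma maximal_chain_below_top x A :
  (forall y, y <= x) -> maximal_chain A = max_chain_below x A.
Proof.
move=> topx; apply/maxsetP/max_chain_belowP => [[cA mA] | [cA _ mA]].
  split=> // z _ zA; rewrite -(mA (z |: A)) ?setU11 ?subsetUr //.
  apply/chainP => a b /setU1P[->|Aa] /setU1P[->|Ab]; rewrite ?comparablexx //.
  - exact: zA.
  - by rewrite comparable_sym zA.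
  - exact: (chainP A cA).
split=> // B /chainP cB sAB; apply/eqP; rewrite eqEsubset sAB andbT.
apply/subsetP => z Bz; apply: mA => // a Aa.
by apply: cB => //; apply: (subsetP sAB).
Qed.

Lemma card_max_chain_below_min x :
  (forall y, y <= x -> y = x) -> #|[set A | max_chain_below x A]| = 1%N.
Proof.
move=> minx; apply/eqP/cards1P; exists [set x]; apply/setP => A.
rewrite !inE; apply/idP/eqP => [mA | ->].
  apply/setP => y; rewrite inE; apply/idP/eqP => [|->].
    by case/max_chain_belowP: mA => _ Ax _ /Ax/minx.
  exact: max_chain_below_top mA.
apply/max_chain_belowP; split.
- by apply/chainP => a b; rewrite !inE => /eqP-> /eqP->; rewrite comparablexx.
- by move=> a; rewrite inE => /eqP->.
- by move=> z /minx-> _; rewrite inE.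
Qed.

Lemma chain_has_max A z : chain A -> z \in A ->
  exists2 y, y \in A & forall a, a \in A -> a <= y.
Proof.
(* [rk] is strictly increasing, so in a chain an element of largest [rk] is the maximum. *)
move=> cA Az; pose rk y := #|[set b | b <= y]|.
case: (@arg_maxnP _ z (mem A) rk Az) => y Ay maxy; exists y => // a Aa.
have /orP[//|ya] := chainP A cA a y Aa Ay.
have [-> //|ny] := eqVneq a y.
suff: (rk y < rk a)%N by rewrite ltnNge => /negP[]; apply: maxy.
apply/proper_card/properP; split.
  by apply/subsetP => b; rewrite !inE => /le_trans->.
exists a; rewrite !inE ?lexx //; apply: contra ny => aley.
by rewrite eq_le aley.
Qed.

(** The only candidate is the maximum of [A :\ x], since two lower covers of [x] in a chain
    coincide. *)
Lemma covered_in_max_chain_below x z A :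
  z < x -> max_chain_below x A ->
  #|[set y | covered_by x y & y \in A]| = 1%N.
Proof.
move=> zx mA; have Ax := max_chain_below_top mA.
case/max_chain_belowP: mA => cA lex mA.
(* If [A] were [[set x]], then [z] would be comparable with all of it and hence belong to it. *)
have [w Aw wx] : exists2 w, w \in A & w != x.
  have [/exists_inP//|/exists_inPn noA] := boolP [exists w in A, w != x].
  have := mA z (ltW zx); rewrite [z \in A](contraTF (@noA z)) ?lt_eqF //.
  move=> /(_ _)/notF[] // a /noA; rewrite negbK => /eqP->.
  exact: lt_comparable.
have cA' : chain (A :\ x).
  by apply/chainP => a b /setD1P[_ Aa] /setD1P[_ Ab]; apply: (chainP A cA).
have Aw' : w \in A :\ x by rewrite !inE wx.
have [y /setD1P[nyx Ay] maxy] := chain_has_max cA' Aw'.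
have yx : y < x by rewrite lt_neqAle nyx lex.
apply/eqP/cards1P; exists y; apply/setP => b; rewrite !inE.
apply/andP/eqP => [[/andP[bx /forallP covb] Ab] | ->].
  apply/eqP; have bley : b <= y by apply: maxy; rewrite !inE lt_eqF.
  by have := covb y; rewrite yx andbT lt_neqAle bley andbT negbK.
split=> //; apply/andP; split=> //; apply/forallP => t.
apply/negP => /andP[yt tx].
(* An element strictly between [y] and [x] is comparable with all of [A], so it lies in [A], against
   the choice of [y]. *)
suff At : t \in A.
  by have := maxy t; rewrite !inE lt_eqF //= At lt_geF // => /(_ isT).
apply: mA => [|a Aa]; first exact: ltW.
have [->|nax] := eqVneq a x; first exact: lt_comparable.
have aley : a <= y by apply: maxy; rewrite !inE nax.
exact/gt_comparable/(le_lt_trans aley).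
Qed.

Lemma max_chain_below_setU1 x y A : covered_by x y ->
  max_chain_below y A -> max_chain_below x (x |: A) /\ x \notin A.
Proof.
case/andP=> yx /forallP cov mA; have Ay := max_chain_below_top mA.
case/max_chain_belowP: mA => cA ley mA.
have ltx a : a \in A -> a < x by move/ley/le_lt_trans; apply.
split; last by apply/negP => /ltx; rewrite ltxx.
apply/max_chain_belowP; split.
- apply/chainP => a b /setU1P[->|Aa] /setU1P[->|Ab]; rewrite ?comparablexx //.
  + exact/gt_comparable/ltx.
  + exact/lt_comparable/ltx.
  + exact: (chainP A cA).
- by move=> a /setU1P[->//|/ltx/ltW].
- move=> z zx zA; rewrite !inE; have [//|nzx] /= := eqVneq z x.
  apply: mA => [|a Aa]; last by apply: zA; rewrite inE Aa orbT.
  have /orP[//|yz] : z >=< y by apply: zA; rewrite inE Ay orbT.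
  have [->//|nyz] := eqVneq z y.
  by have := cov z; rewrite !lt_neqAle yz zx nzx eq_sym nyz.
Qed.

Lemma max_chain_below_setD1 x y A : covered_by x y -> y \in A ->
  max_chain_below x A -> max_chain_below y (A :\ x).
Proof.
case/andP=> yx /forallP cov Ay /max_chain_belowP[/chainP cA lex mA].
apply/max_chain_belowP; split.
- by apply/chainP => a b /setD1P[_ Aa] /setD1P[_ Ab]; apply: cA.
- move=> a /setD1P[nax Aa]; have /orP[//|ya] := cA a y Aa Ay.
  have [->//|nay] := eqVneq a y.
  by have := cov a; rewrite !lt_neqAle ya lex // nax eq_sym nay.
- move=> z zy zA; have zx := le_lt_trans zy yx.
  rewrite !inE lt_eqF //=; apply: mA => [|a Aa]; first exact: ltW.
  have [->|nax] := eqVneq a x; first exact: lt_comparable.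
  by apply: zA; rewrite !inE nax.
Qed.

(** Double counting: each chain passes through exactly one lower cover [y] of [x], and removing [x]
    matches the chains through [y] with the maximal chains below [y]. The element [z] says that [x]
    is not minimal. *)
Lemma card_max_chain_below_cover x z : z < x ->
  #|[set A | max_chain_below x A]|
  = (\sum_(y | covered_by x y) #|[set A | max_chain_below y A]|)%N.
Proof.
move=> zx; rewrite -sum1_card.
transitivity (\sum_(A in [set A | max_chain_below x A])
               \sum_(y | covered_by x y) (y \in A))%N.
  apply: eq_bigr => A; rewrite inE => mA.
  rewrite -(covered_in_max_chain_below zx mA) -sum1_card -big_mkcondr.
  by apply: eq_bigl => y; rewrite inE.
rewrite exchange_big; apply: eq_bigr => y cov.
rewrite -big_mkcondr sum1_card.
have injU : {in [set A | max_chain_below y A] &, injective (setU [set x])}.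
  move=> A B; rewrite !inE => /(max_chain_below_setU1 cov)[_ xA].
  move=> /(max_chain_below_setU1 cov)[_ xB] /(congr1 (fun C => C :\ x)).
  by rewrite !setU1K.
rewrite -(card_in_imset injU); apply: eq_card => A; rewrite unfold_in inE.
apply/andP/imsetP => [[mA Ay] | [B]].
  exists (A :\ x); first by rewrite inE; apply: max_chain_below_setD1.
  by rewrite setD1K // (max_chain_below_top mA).
rewrite inE => mB ->; rewrite !inE (max_chain_below_top mB) orbT.
by have [] := max_chain_below_setU1 cov mB.
Qed.

End ChainsBelow.

(** * Partitions into blocks of equal size *)

Section MPartitions.
Variables (m : nat) (T : finType).
Implicit Types (x : T) (B D : {set T}) (P : {set {set T}}).

(** Relative to a subset [D], so that removing a block stays within the same type [T]. *)
Definition m_partition_of D P : bool :=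
  partition P D && [forall B in P, #|B| == m].

Lemma card_sets_containing D x k : x \in D ->
  #|[set B : {set T} | [&& B \subset D, x \in B & #|B| == k.+1]]|
  = 'C(#|D|.-1, k).
Proof.
move=> Dx; rewrite (cardsD1 x D) Dx /= -cards_draws.
rewrite -(card_in_imset (f := setU [set x])); last first.
  move=> A B; rewrite !inE => /andP[/subsetP sA _] /andP[/subsetP sB _].
  move=> /(congr1 (fun C => C :\ x)); rewrite !setU1K //.
    by apply/negP => /sB; rewrite !inE eqxx.
  by apply/negP => /sA; rewrite !inE eqxx.
apply: eq_card => B; rewrite !inE; apply/and3P/imsetP => [[sBD Bx cB] | [A]].
  exists (B :\ x); last by rewrite setD1K.
  by rewrite inE setSD // -eqSS -(eqP cB) (cardsD1 x B) Bx add1n eqxx.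
rewrite inE => /andP[/subsetP sA /eqP cA] ->.
have xA : x \notin A by apply/negP => /sA; rewrite !inE eqxx.
rewrite setU11 cardsU1 xA cA; split=> //.
by apply/subsetP => a /setU1P[->//|/sA]; rewrite !inE => /andP[].
Qed.

Lemma card_m_partition_of_block D x : x \in D ->
  #|[set P | m_partition_of D P]|
  = \sum_(B : {set T} | [&& B \subset D, x \in B & #|B| == m])
      #|[set P | m_partition_of (D :\: B) P]|.
Proof.
move=> Dx; rewrite -sum1_card.
rewrite (partition_big (fun P => pblock P x)
  (fun B => [&& B \subset D, x \in B & #|B| == m])) /=; last first.
  move=> P; rewrite inE => /andP[pP /forall_inP cP].
  have xP : x \in cover P by rewrite (cover_partition pP).
  rewrite mem_pblock xP cP ?pblock_mem // andbT.
  by rewrite -(cover_partition pP) /cover (bigcup_max _ (pblock_mem xP)).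
apply: eq_bigr => B /and3P[sBD Bx cB]; rewrite sum1_card.
have BD P : partition P (D :\: B) -> B \notin P.
  move=> pP; apply/negP => PB; have : x \in cover P by apply/bigcupP; exists B.
  by rewrite (cover_partition pP) !inE Bx.
rewrite -[RHS](card_in_imset (f := setU [set B])); last first.
  move=> P Q; rewrite !inE => /andP[/BD nP _] /andP[/BD nQ _].
  by move=> /(congr1 (fun C => C :\ B)); rewrite !setU1K.
apply: eq_card => P; rewrite unfold_in inE.
apply/andP/imsetP => [[/andP[pP /forall_inP cP] /eqP pB] | [Q]].
  have PB : B \in P by rewrite -pB pblock_mem // (cover_partition pP).
  exists (P :\ B); last by rewrite setD1K.
  rewrite inE /m_partition_of partitionD1 //=; apply/forall_inP => C.
  by rewrite inE => /andP[_ /cP].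
rewrite inE => /andP[pQ /forall_inP cQ] ->.
have pU : partition (B |: Q) D.
  have -> : D = B :|: D :\: B by rewrite -{1}(setID D B) (setIidPr sBD).
  apply: partitionU1 => //; first by apply/set0Pn; exists x.
  by rewrite disjoints_subset setCD subsetUr.
split; last first.
  by apply/eqP/def_pblock; rewrite ?setU11 //; case/and3P: pU.
rewrite /m_partition_of pU; apply/forall_inP => C /setU1P[->//|].
exact: cQ.
Qed.

(** The block of a fixed element can be chosen in ['C(#|D|.-1, m.-1)] ways, and what remains has
    [m * n] elements whatever the choice. *)
Lemma card_m_partition_of n D : 0 < m -> #|D| = m * n ->
  #|[set P | m_partition_of D P]| = \prod_(i < n) 'C((m * i.+1).-1, m.-1).
Proof.
move=> m_gt0; elim: n D => [|n IHn] D cD.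
  have -> : D = set0 by apply/eqP; rewrite -cards_eq0 cD muln0 eqxx.
  rewrite big_ord0; apply/eqP/cards1P; exists set0; apply/setP => P.
  rewrite !inE /m_partition_of partition_set0 andb_idr // => /eqP->.
  by apply/forall_inP => B; rewrite inE.
have [x Dx] : exists x, x \in D.
  by apply/set0Pn; rewrite -card_gt0 cD muln_gt0 m_gt0.
rewrite (card_m_partition_of_block Dx) big_ord_recr /= -cD.
rewrite -(card_sets_containing _ Dx) prednK // mulnC -sum_nat_const.
rewrite (eq_bigl (fun B => B \in [set B : {set T} |
  [&& B \subset D, x \in B & #|B| == m]])); last by move=> B; rewrite inE.
apply: eq_bigr => B; rewrite inE => /and3P[sBD _ /eqP cB].
by apply: IHn; rewrite cardsDS // cD cB mulnS addKn.
Qed.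

End MPartitions.

Lemma card_m_partition m n (T : finType) : 0 < m -> #|T| = m * n ->
  #|[set P : {set {set T}} | m_partition m P]|
  = \prod_(i < n) 'C((m * i.+1).-1, m.-1).
Proof. by move=> m_gt0 cT; apply: card_m_partition_of; rewrite ?cardsT. Qed.

Lemma prod_bin_fact m n : 0 < m ->
  (\prod_(i < n) 'C((m * i.+1).-1, m.-1)) * (m`! ^ n * n`!) = (m * n)`!.
Proof.
move=> m_gt0; elim: n => [|n IHn]; first by rewrite big_ord0 muln0.
rewrite big_ord_recr /= expnS (factS n).
have le : m.-1 <= (m * n.+1).-1 by rewrite -!subn1 leq_sub2r // leq_pmulr.
have pos : 0 < m * n.+1 by rewrite muln_gt0 m_gt0.
have sub : (m * n.+1).-1 - m.-1 = m * n.
  by rewrite -!subn1 subnBA // subnK // mulnS addKn.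
have -> : (m * n.+1)`! = m * n.+1 * (m * n.+1).-1`!.
  by rewrite -{1}(prednK pos) factS (prednK pos).
rewrite -(bin_fact le) sub -IHn.
have -> : m`! = m * m.-1`! by rewrite -{1}(prednK m_gt0) factS (prednK m_gt0).
ring.
Qed.

Lemma eq_card_bijective (T1 T2 : finType) :
  #|T1| = #|T2| -> exists g : T1 -> T2, bijective g.
Proof.
move=> eqT; exists (fun x => enum_val (cast_ord eqT (enum_rank x))).
exists (fun y => enum_val (cast_ord (esym eqT) (enum_rank y))) => z;
by rewrite enum_valK ?cast_ordK ?cast_ordKV enum_rankK.
Qed.

(** * Sequences of block sizes *)

Section Compositions.
Implicit Types s t : seq nat.

Fixpoint zeros_last s : bool :=
  if s is a :: s' then ((0 < a) || (sumn s' == 0)) && zeros_last s' else true.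

Fixpoint decrements s : seq (seq nat) :=
  if s is a :: s' then
    (if a is a'.+1 then [:: a' :: s'] else [::])
      ++ [seq a :: t | t <- decrements s']
  else [::].

(* The binomial counts the sets of [a] elements out of [a + b] that contain   *)
(* the least one.                                                             *)
Definition head_choices a b : nat :=
  if a is a'.+1 then 'C(a' + b, a') else b == 0.

Fixpoint path_count s : nat :=
  if s is a :: s' then head_choices a (sumn s') * path_count s' else 1.

(** Lets the recurrence run over all decrements: those outside the image of the poset contribute
    nothing. *)
Lemma path_count_not_zeros_last s : ~~ zeros_last s -> path_count s = 0.
Proof.
elim: s => //= a s IHs; rewrite negb_and => /orP[|/IHs->]; last first.
  by rewrite muln0.
by case: a => //=; case: (sumn s).
Qed.

Lemma all2_leq_sumn s t : all2 leq s t -> sumn s <= sumn t.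
Proof. by elim: s t => [|a s IHs] [|b t] //= /andP[ab /IHs]; lia. Qed.

Lemma all2_leq_sumn_eq s t : all2 leq s t -> sumn t <= sumn s -> s = t.
Proof.
elim: s t => [|a s IHs] [|b t] //= /andP[ab st] le.
have := all2_leq_sumn st => le'.
by rewrite (IHs t) //; [congr (_ :: _)|]; lia.
Qed.

Lemma all2_leq_refl s : all2 leq s s.
Proof. by elim: s => //= a s ->; rewrite leqnn. Qed.

(** The sum is the rank function of the componentwise order, so membership reduces to order and
    rank. *)
Lemma mem_decrements s t :
  (t \in decrements s) = all2 leq t s && (sumn s == (sumn t).+1).
Proof.
elim: s t => [|a s IHs] [|b t] //=.
  by apply/negbTE; rewrite mem_cat negb_or; apply/andP; split;
    [case: a | apply/negP => /mapP[]].
have consE c : (b :: t \in [seq c :: u | u <- decrements s])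
    = (b == c) && (t \in decrements s).
  apply/mapP/andP => [[u us [-> ->]]|[/eqP-> ts]]; first by rewrite eqxx us.
  by exists t.
rewrite mem_cat consE IHs.
have -> : (b :: t \in (if a is a'.+1 then [:: a' :: s] else [::]))
    = (a == b.+1) && (t == s).
  by case: a => [|a]; rewrite ?inE ?eqseq_cons ?eqSS ?[a == b]eq_sym.
apply/idP/idP => [/orP[/andP[/eqP-> /eqP->]|/and3P[/eqP-> -> /eqP->]]|].
- by rewrite all2_leq_refl leqnSn /= addSn.
- by rewrite leqnn addnS /=.
case/andP=> /andP[ba ts] /eqP e; have := all2_leq_sumn ts => le.
have [eba|nba] := eqVneq b a.
  by apply/orP; right; rewrite ts /=; apply/eqP; lia.
have -> : t = s by apply: all2_leq_sumn_eq => //; lia.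
by rewrite eqxx andbT; apply/orP; left; apply/eqP; lia.
Qed.

Lemma decrements_uniq s : uniq (decrements s).
Proof.
elim: s => //= a s IHs; rewrite cat_uniq map_inj_uniq ?IHs; last first.
  by move=> u v [].
rewrite andbT; case: a => [|a] /=; first by apply/hasPn.
by apply/hasPn => _ /mapP[u _ ->]; rewrite inE eqseq_cons; lia.
Qed.

(* Decrementing the last entry where [t] and [s] differ keeps zeros last. *)
Lemma zeros_last_decrement s t : zeros_last s -> zeros_last t ->
  all2 leq t s -> t != s ->
  exists z, [/\ z \in decrements s, zeros_last z & all2 leq t z].
Proof.
elim: s t => [|b s IHs] [|a t] //= /andP[vb vs] /andP[va vt] /andP[ab ts] ne.
have [ets|nts] := eqVneq t s.
  subst t; have ltab : a < b.
    by rewrite ltn_neqAle ab andbT; apply: contra ne => /eqP->.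
  case: b ltab {ab ne vb} => // b ab; exists (b :: s).
  rewrite mem_cat inE eqxx /= vs all2_leq_refl !andbT.
  move: ab; rewrite ltnS => ab.
  by split=> //; lia.
have [z [zs vz tz]] := IHs t vs vt ts nts; exists (b :: z).
rewrite mem_cat map_f ?orbT //= ab tz vz andbT; split=> //.
case/orP: vb => [->//|/eqP s0]; case/negP: nts; apply/eqP.
by apply: all2_leq_sumn_eq; rewrite ?s0.
Qed.

(** Pascal's rule: decrementing the head changes only the first binomial to its [a.-1] term;
    decrementing the tail lowers its sum by one and, by induction, preserves the other factor. *)
Lemma path_count_decrements s : zeros_last s -> 0 < sumn s ->
  path_count s = \sum_(t <- decrements s) path_count t.
Proof.
elim: s => //= a s IHs /andP[va vs] pos; rewrite big_cat big_map /=.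
have -> : \sum_(t <- decrements s) head_choices a (sumn t) * path_count t
    = head_choices a (sumn s).-1 * \sum_(t <- decrements s) path_count t.
  rewrite big_distrr /= !big_seq; apply: eq_bigr => t.
  by rewrite mem_decrements => /andP[_ /eqP->].
case: a va pos => [|a] va pos; first by move: va => /= /eqP e; lia.
(* With a zero tail only the head can be decremented, and both binomials are 1. *)
rewrite big_seq1 /=; have [s0|s_gt0] := posnP (sumn s).
  have -> : decrements s = [::].
    case e: (decrements s) => [//|t l].
    by have := mem_head t l; rewrite -e mem_decrements s0 andbF.
  rewrite big_nil muln0 addn0 s0 addn0 binn.
  by case: a {va pos} => [|a] //=; rewrite addn0 binn.
rewrite -IHs // -mulnDl; congr (_ * _).
case: a {va pos} => [|a] /=; first by rewrite !bin0; case: (sumn s) s_gt0.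
by case: (sumn s) s_gt0 => // b _; rewrite addnS binS addnC addSnnS.
Qed.

Lemma zeros_last_nseq0 k : zeros_last (nseq k 0).
Proof. by elim: k => //= k ->; rewrite sumn_nseq. Qed.

Lemma zeros_last_cat s k : all (leq 1) s -> zeros_last (s ++ nseq k 0).
Proof.
elim: s => [_|a s IHs] /=; first exact: zeros_last_nseq0.
by case/andP=> -> /IHs->.
Qed.

Lemma zeros_last_split s : zeros_last s ->
  exists t k, all (leq 1) t /\ s = t ++ nseq k 0.
Proof.
elim: s => [|a s IHs] /=; first by exists [::], 0.
case/andP=> va /IHs[t [k [pt e]]]; case: a va => [|a] /= va; last first.
  by exists (a.+1 :: t), k; rewrite /= pt e.
exists [::], k.+1; split=> //=; congr cons; rewrite e.
case: t e pt => [//|b t] e /= /andP[b0 _]; move: va; rewrite e /= => /eqP; lia.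
Qed.

Lemma path_count_nseq0 k : path_count (nseq k 0) = 1.
Proof. by elim: k => //= k ->; rewrite sumn_nseq mul0n. Qed.

Lemma path_count_nseq m n : 0 < m ->
  path_count (nseq n m) = \prod_(i < n) 'C((m * i.+1).-1, m.-1).
Proof.
case: m => // m _; elim: n => [|n IHn]; first by rewrite big_ord0.
by rewrite big_ord_recr /= IHn mulnC sumn_nseq; congr (_ * 'C(_, _)); lia.
Qed.

End Compositions.

(** * The stacked cubes *)

Lemma all2_cat (T1 T2 : Type) (r : T1 -> T2 -> bool) s1 s2 t1 t2 :
  size s1 = size t1 ->
  all2 r (s1 ++ s2) (t1 ++ t2) = all2 r s1 t1 && all2 r s2 t2.
Proof.
by elim: s1 t1 => [|a s IHs] [|b t] //= [/IHs->]; rewrite andbA.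
Qed.

Lemma all2_rev (T1 T2 : Type) (r : T1 -> T2 -> bool) s t :
  size s = size t -> all2 r (rev s) (rev t) = all2 r s t.
Proof.
elim: s t => [|a s IHs] [|b t] //= [e].
by rewrite !rev_cons -!cats1 all2_cat ?size_rev // IHs //= andbT andbC.
Qed.

(** The zeros added by the stacking maps and the zeros of absent blocks both lie below everything,
    so passing from coordinates to sizes does not affect the comparison. *)
Lemma all2_leq_succ e s t :
  all2 leq (nseq e 0 ++ s) t = all2 leq (nseq e 0 ++ map S s) (map S t).
Proof.
elim: e t => [|e IHe] t; last by case: t => //=.
by elim: s t => [|a s IHs] [|b t] //=; rewrite IHs.
Qed.

Section BlockSizes.
Variables (r n : nat).
Local Open Scope order_scope.
Notation U := (stacked_cubes r n).

(* The newest coordinate of a cube is its first one, hence the reversal. *)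
Definition block_sizes (u : U) : seq nat :=
  rev (nseq (n - tag u) 0 ++ [seq (val a).+1 | a <- (tagged u : _.-tuple _)])%N.

Lemma size_block_sizes u : size (block_sizes u) = n.
Proof.
rewrite size_rev size_cat size_nseq size_map size_tuple subnK //.
by rewrite -ltnS ltn_ord.
Qed.

Lemma le_cubeE k (x y : cube r k) :
  (x <= y) = all2 leq (map val (x : _.-tuple _)) (map val (y : _.-tuple _)).
Proof.
case: x y => [s /= ss] [t /= st].
transitivity ((s : seqprod 'I_r.+1) <= t); first by [].
have {ss st} : size s = size t by rewrite (eqP ss) (eqP st).
by elim: s t => [|a s IHs] [|b t] //= [/IHs<-].
Qed.

Lemma stack_compE j e (x : cube r j) :
  map val (stack_comp
      (fun i => @cube_cons0 r i : {omorphism cube r i -> cube r i.+1}) e x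
    : _.-tuple _)
  = nseq e 0%N ++ map val (x : _.-tuple _).
Proof. by elim: e => //= e ->. Qed.

Lemma le_block_sizes (u v : U) :
  (u <= v) = all2 leq (block_sizes u) (block_sizes v).
Proof.
have := size_block_sizes u; have := size_block_sizes v.
rewrite /block_sizes !size_rev => sv su.
rewrite all2_rev ?su ?sv // {su sv}.
case: u v => [j x] [k y] /=; rewrite -[LHS]/(lax_le_at _ x y).
have jn : (j <= n)%N by rewrite -ltnS ltn_ord.
have kn : (k <= n)%N by rewrite -ltnS ltn_ord.
move: (nat_of_ord j) (nat_of_ord k) jn kn x y => {}j {}k jn kn x y.
have [jk|kj] := leqP j k.
  move: (k - j)%N (subnK jk) => e E; subst k.
  rewrite lax_le_atE le_cubeE stack_compE.
  (* Once the common padding is removed, [e] zeros remain before [x], as in its image under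
     stacking. *)
  have -> : (n - j = (n - (e + j)) + e)%N by lia.
  rewrite nseqD -catA all2_cat ?size_nseq // all2_leq_refl /=.
  rewrite [in RHS](map_comp S val) [in RHS](map_comp S val y).
  exact: all2_leq_succ.
transitivity false.
  by apply/negP => /lax_le_at_leq; rewrite leqNgt kj.
(* Past the [n - j] common zeros, a positive size of [x] meets a padding zero of [y]. *)
have -> : (n - k = (n - j) + (j - k).-1.+1)%N by lia.
rewrite nseqD -catA all2_cat ?size_nseq // all2_leq_refl /=.
have : size (x : _.-tuple _) = j by rewrite size_tuple.
by case: (x : seq _) => [|a s] //= e; lia.
Qed.

Lemma block_sizes_inj : injective block_sizes.
Proof.
move=> u v e; apply/eqP; rewrite eq_le !le_block_sizes e.
by rewrite all2_leq_refl.
Qed.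

Lemma block_sizesP s :
  reflect (exists u, block_sizes u = s)
    [&& size s == n, all (geq r.+1) s & zeros_last s].
Proof.
apply: (iffP and3P) => [[/eqP sz bs /zeros_last_split[t [k [pt e]]]] | [u <-]].
  have tn : (size t < n.+1)%N by rewrite ltnS -sz e size_cat leq_addr.
  (* The inverse drops the zeros, restores newest-first order and subtracts one; entries are at most
     [r.+1], so [inord] never takes its default value. *)
  pose x := [tuple of [seq inord a.-1 : 'I_r.+1 | a <- rev (in_tuple t)]].
  exists (existT (fun j : 'I_n.+1 => cube r j : Type) (Ordinal tn) x).
  rewrite /block_sizes /= rev_cat rev_nseq -map_rev -map_rev revK -map_comp.
  have -> : (n - size t = k)%N by rewrite -sz e size_cat size_nseq addKn.
  rewrite e; congr cat; rewrite -[RHS]map_id; apply/eq_in_map => a ta /=.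
  have a_gt0 : (0 < a)%N := allP pt a ta.
  have : (a <= r.+1)%N.
    by have /allP/(_ a) := bs; rewrite e mem_cat ta => /(_ isT).
  by move=> ar; rewrite inordK prednK.
rewrite size_block_sizes eqxx; split=> //.
  apply/allP => a; rewrite mem_rev mem_cat => /orP[/nseqP[->]//|].
  by case/mapP=> b _ ->; rewrite /= ltn_ord.
rewrite /block_sizes rev_cat rev_nseq zeros_last_cat // all_rev.
by apply/allP => a /mapP[b _ ->].
Qed.

Lemma block_sizes_bound (u : U) s :
  all2 leq s (block_sizes u) -> zeros_last s -> exists v, block_sizes v = s.
Proof.
move=> su vs; apply/block_sizesP; rewrite vs andbT.
have /block_sizesP : exists v, block_sizes v = block_sizes u by exists u.
case/and3P=> /eqP <- + _.
elim: s (block_sizes u) su {vs} => [|a s IHs] [|b t] //=.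
case/andP=> ab /IHs{}IHs /andP[br /IHs/andP[/eqP-> ->]].
by rewrite eqxx andbT /=; apply: leq_trans ab br.
Qed.

Lemma zeros_last_block_sizes u : zeros_last (block_sizes u).
Proof.
have /block_sizesP/and3P[] // : exists v, block_sizes v = block_sizes u.
by exists u.
Qed.

(** If [v < u], some valid decrement of [u] lies above [v], and covering forces it to be [v].
    Conversely, sums increase strictly along [<], so a drop of one leaves no room in between. *)
Lemma covered_by_block_sizes (u v : U) :
  covered_by u v = (block_sizes v \in decrements (block_sizes u)).
Proof.
apply/andP/idP => [[vu /forallP cov] | ].
  have [z [zd vz lez]] : exists z, [/\ z \in decrements (block_sizes u),
      zeros_last z & all2 leq (block_sizes v) z].
    apply: zeros_last_decrement; rewrite ?zeros_last_block_sizes //.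
      by rewrite -le_block_sizes ltW.
    by apply: contraTneq vu => /block_sizes_inj->; rewrite ltxx.
  have /andP[zu /eqP su] : all2 leq z (block_sizes u)
      && (sumn (block_sizes u) == (sumn z).+1) by rewrite -mem_decrements.
  have [w ew] := block_sizes_bound zu vz; rewrite -ew in zd zu su lez *.
  move: zu lez; rewrite -!le_block_sizes => wu vw.
  have := cov w; rewrite !lt_neqAle vw wu !andbT.
  have -> /= : w != u.
    by apply: contraPneq su => ->; lia.
  by rewrite andbT negbK => /eqP->.
rewrite mem_decrements -le_block_sizes => /andP[vu /eqP su]; split.
  by rewrite lt_neqAle vu andbT; apply: contraPneq su => ->; lia.
apply/forallP => w; apply/negP => /andP[vw wu].
have lts (a b : U) : a < b -> (sumn (block_sizes a) < sumn (block_sizes b))%N.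
  rewrite lt_neqAle le_block_sizes => /andP[nab ab]; rewrite ltnNge.
  by apply: contra nab => /(all2_leq_sumn_eq ab)/block_sizes_inj->.
by have := lts _ _ vw; have := lts _ _ wu; lia.
Qed.

Lemma card_max_chain_below (u : U) :
  #|[set A | max_chain_below u A]| = path_count (block_sizes u).
Proof.
have [k] := ubnP (sumn (block_sizes u)); elim: k u => // k IHk u lek.
have vu := zeros_last_block_sizes u.
have [bot ebot] : exists v, block_sizes v = nseq n 0%N.
  apply/block_sizesP; rewrite size_nseq eqxx zeros_last_nseq0 andbT.
  by apply/allP => a /nseqP[->].
have lebot (v : U) : bot <= v.
  rewrite le_block_sizes ebot -[in nseq n _](size_block_sizes v).
  by elim: (block_sizes v) => //= a s ->.
have [eu|nu] := eqVneq u bot.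
  rewrite eu ebot path_count_nseq0 card_max_chain_below_min // => y yb.
  by apply/eqP; rewrite eq_le yb lebot.
have botu : bot < u by rewrite lt_neqAle eq_sym nu lebot.
have su : (0 < sumn (block_sizes u))%N.
  rewrite lt0n; apply: contraNneq nu => su; apply/eqP/block_sizes_inj/esym.
  by apply: all2_leq_sumn_eq; rewrite -?le_block_sizes ?su.
rewrite (card_max_chain_below_cover botu) path_count_decrements //.
rewrite (bigID zeros_last) /= [X in (_ + X)%N]big1 ?addn0; last first.
  by move=> s /path_count_not_zeros_last.
(* The surviving decrements are, up to permutation, the size sequences of the lower covers of
   [u]. *)
transitivity (\sum_(s <- [seq block_sizes v | v <- enum (covered_by u)])
                path_count s)%N.
  rewrite big_map big_enum /=; apply: eq_bigr => v.
  rewrite covered_by_block_sizes mem_decrements => /andP[_ /eqP sv].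
  by apply: IHk; lia.
rewrite -[RHS]big_filter; apply: perm_big; apply: uniq_perm.
- by rewrite map_inj_uniq ?enum_uniq //; apply: block_sizes_inj.
- exact/filter_uniq/decrements_uniq.
move=> s; rewrite mem_filter; apply/mapP/andP => [[v + ->] | [vs ds]].
  rewrite mem_enum -[_ \in covered_by u]/(covered_by u v).
  by rewrite covered_by_block_sizes zeros_last_block_sizes.
have [v ev] : exists v, block_sizes v = s.
  apply: (@block_sizes_bound u) => //.
  by move: ds; rewrite mem_decrements => /andP[].
exists v => //; rewrite mem_enum -[_ \in covered_by u]/(covered_by u v).
by rewrite covered_by_block_sizes ev.
Qed.

End BlockSizes.

Lemma card_maximal_chain m n : 0 < m ->
  #|[set A : {set stacked_cubes m.-1 n} | maximal_chain A]|
  = \prod_(i < n) 'C((m * i.+1).-1, m.-1).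
Proof.
move=> m_gt0.
(* Coordinates reach [m.-1], so sizes reach [m], and [n] full blocks form the greatest element. *)
have [top etop] : exists u : stacked_cubes m.-1 n, block_sizes u = nseq n m.
  apply/block_sizesP; rewrite size_nseq eqxx prednK //=.
  apply/andP; split; first by apply/allP => a /nseqP[-> _] /=.
  by elim: n => //= n ->; rewrite m_gt0.
rewrite -path_count_nseq // -etop -card_max_chain_below; apply: eq_card => A.
rewrite !inE; apply: maximal_chain_below_top => u.
have /block_sizesP/and3P[/eqP sz bd _] :
  exists v : stacked_cubes m.-1 n, block_sizes v = block_sizes u by exists u.
rewrite le_block_sizes etop -[in nseq n _]sz; move: bd; rewrite prednK //.
by elim: (block_sizes u) => //= a s IHs /andP[-> /IHs].
Qed.

Theorem theorem1p2 (m n : nat) (m_gt0 : 0 < m) :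
  (forall T : finType, #|T| = m * n ->
     exists g : {A : {set stacked_cubes m.-1 n} | maximal_chain A} ->
                {P : {set {set T}} | m_partition m P},
       bijective g)
  /\
  (#|[set A : {set stacked_cubes m.-1 n} | maximal_chain A]|%:R
   = (m * n)%N`!%:R / (m`!%:R ^+ n * n`!%:R) :> rat)%R.
Proof.
split=> [T cT|].
  apply: eq_card_bijective; rewrite !card_sig.
  have := card_maximal_chain n m_gt0; rewrite -(card_m_partition m_gt0 cT).
  by rewrite !cardsE.
rewrite card_maximal_chain // -(prod_bin_fact n m_gt0).
rewrite !(GRing.natrM, GRing.natrX) GRing.mulfK // -GRing.natrX -GRing.natrM.
by rewrite Num.Theory.pnatr_eq0 -lt0n muln_gt0 expn_gt0 !fact_gt0.
Qed.
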